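(* Let $d\ge1$ be an integer, let $\sigma_d=\frac12-\frac1{2d}$, and let $\alpha>0$ be such that $$\sum_{n=1}^\infty |a_n|\,n^{-\sigma_d}(\log n)^\alpha<\infty\quad\text{for each } f(s)=\sum_{n=1}^\infty a_nn^{-s}\in\mathcal{H}^\infty(d).$$ Then $\alpha\le\frac{d-1}{2}$.
   Context: $\mathbb{C}_0=\{s\in\mathbb{C}:\operatorname{Re}s>0\}$. $\mathcal{H}^\infty$ denotes the set of Dirichlet series $f(s)=\sum_{n=1}^\infty a_nn^{-s}$ (with complex coefficients, convergent in some half-plane) which are analytic and bounded in $\mathbb{C}_0$, i.e. whose sum has a bounded analytic extension to $\mathbb{C}_0$; it is normed by $\|f\|_\infty=\sup_{s\in\mathbb{C}_0}|f(s)|$. For a positive integer $n$, $\Omega(n)$ is the number of prime divisors of $n$ counted with multiplicity. For an integer $d\ge1$, $\mathcal{H}^\infty(d)$ is the subspace of those $f(s)=\sum a_nn^{-s}\in\mathcal{H}^\infty$ such that $a_n\ne0\Rightarrow\Omega(n)\le d$. *)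

(* Defs.v *)
From Stdlib Require Import Reals.
From Coquelicot Require Import Coquelicot.
From mathcomp Require Import all_boot.

Set Implicit Arguments.
Unset Strict Implicit.
Unset Printing Implicit Defensive.

Local Open Scope R_scope.

Definition Cexp (z : C) : C :=
  (exp (Re z) * cos (Im z), exp (Re z) * sin (Im z)).

(* [n^{-s} = exp (- s log n)], used for [n >= 1] only. *)
Definition npowC (n : nat) (s : C) : C :=
  Cexp (Copp (Cmult s (RtoC (ln (INR n))))).

(* [x ^ y] with [0 ^ y = 0]; Stdlib has [ln 0 = 0], hence [Rpower 0 y = 1],
   which is wrong for the factor [(log n) ^ alpha] at [n = 1]. *)
Definition powR0 (x y : R) : R :=
  if Rlt_dec 0 x then Rpower x y else 0.

Definition Omega (n : nat) : nat := (\sum_(p <- primes n) logn p n)%N.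

(* A Dirichlet series is given by its coefficients [a n], [n >= 1] ([a 0] plays
   no role). Series being indexed from [0], the [k]-th term is the one of
   [n = k + 1]. *)
Definition dirichlet_term (a : nat -> C) (s : C) (k : nat) : C :=
  Cmult (a k.+1) (npowC k.+1 s).

(* [sigma0 >= 0] is no restriction, and makes [Re s > sigma0] lie in the
   half-plane [Re s > 0] on which [F] is the bounded analytic extension. *)
Definition Hinf (a : nat -> C) : Prop :=
  exists (sigma0 : R) (F : C -> C),
    0 <= sigma0 /\
    (forall s : C, sigma0 < Re s ->
       @is_series C_AbsRing C_NormedModule (dirichlet_term a s) (F s)) /\
    (forall s : C, 0 < Re s -> @ex_derive C_AbsRing C_NormedModule F s) /\
    (exists M : R, forall s : C, 0 < Re s -> Cmod (F s) <= M).

Definition Hinf_deg (d : nat) (a : nat -> C) : Prop :=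
  Hinf a /\
  forall n : nat, (1 <= n)%N -> a n <> RtoC 0 -> (Omega n <= d)%N.

Definition sigma_crit (d : nat) : R := 1 / 2 - 1 / (2 * INR d).

(* Main.v *)
(** Let N be a power of 2, H the Hadamard matrix of order N and q(j,i), j < d,
    i < N, distinct primes in (sqrt X, X]. Starting from the vector (1,...,1),
    multiply d times alternately by the coordinates q(j,i)^-s and by H. Since
    H / sqrt N is an isometry, the first coordinate of the result is bounded by
    N^((d+1)/2) for Re s > 0, while by unique factorization it is a Dirichlet
    polynomial with N^d coefficients +1 or -1, at integers n with Omega(n) = d
    and X^(d/2) < n <= X^d. By Chebyshev's estimate N can be taken of order
    X / log X, and then the weighted coefficient sum of this polynomial divided
    by N^((d+1)/2) is at least of order (log X)^(alpha - (d-1)/2).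

    If alpha > (d-1)/2, multiples P_k of such polynomials, with disjoint supports,
    sup norm at most 2^-k and weighted coefficient sum at least 1, add up to a
    counterexample. That the sum is holomorphic follows without Cauchy's theory:
    the isometry argument also bounds P_k' and the second order Taylor remainder
    of P_k on Re s >= delta by 2^-k times a constant depending only on d and
    delta, because each p^-s satisfies such bounds uniformly in p. *)

Require Import Defs.
From Stdlib Require Import Reals.
From Coquelicot Require Import Coquelicot.
From mathcomp Require Import all_boot.
From HB Require Import structures.
From Stdlib Require Import Lra ClassicalEpsilon.
From mathcomp Require Import zify.

Local Open Scope R_scope.

(** * Chebyshev's lower bound for the number of primes *)

Definition primes_upto (n : nat) : seq nat := [seq p <- iota 1 n | prime p].

Lemma mem_primes_upto n p : (p \in primes_upto n) = prime p && (p <= n)%N.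
Proof.
rewrite mem_filter mem_iota add1n ltnS; case Hp: (prime p) => //=.
by rewrite prime_gt0.
Qed.

Lemma size_primes_upto_le n : (size (primes_upto n) <= n)%N.
Proof. by rewrite size_filter; apply: leq_trans (count_size _ _) _; rewrite size_iota. Qed.

(** By Legendre's formula the exponent is the sum over k of floor(2n/p^k) - 2 floor(n/p^k). Each
    term is 0 or 1, and it vanishes once p^k > 2n. *)
Lemma logn_central_bin n p : prime p -> (0 < n)%N ->
  (logn p 'C(n.*2, n) <= trunc_log p n.*2)%N.
Proof.
move=> pp n0.
have nn : (n <= n.*2)%N by rewrite -addnn leq_addr.
have p1 := prime_gt1 pp.
have: logn p (n.*2)`! = (logn p 'C(n.*2, n) + (logn p n`! + logn p n`!))%N.
  rewrite -(bin_fact nn) -addnn addnK !lognM ?muln_gt0 ?fact_gt0 ?bin_gt0 //.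
  exact: leq_addr.
set T := trunc_log p n.*2.
have T2 : (T <= n.*2)%N.
  have h := trunc_logP p1 (_ : 0 < n.*2)%N; rewrite double_gt0 in h.
  by apply: leq_trans (ltnW (ltn_expl _ p1)) (h n0).
(* Legendre's sums for n! and (2n)! are padded with zero terms to a common range. *)
have wide m : (m <= n.*2)%N ->
    logn p m`! = (\sum_(1 <= k < n.*2.+1) m %/ p ^ k)%N.
  move=> mn; rewrite logn_fact // [RHS](@big_cat_nat _ _ _ m.+1) //=.
  rewrite [X in _ = (_ + X)%N]big1_seq ?addn0 // => k /andP[_].
  rewrite mem_index_iota => /andP[mk _]; apply: divn_small.
  exact: leq_trans mk (ltnW (ltn_expl _ p1)).
rewrite (wide n.*2) // (wide n) // -big_split /=.
(* Written as a sum of indicators over the same range, [T] can be compared term by term. *)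
have -> : T = (\sum_(1 <= k < n.*2.+1) (k <= T))%N.
  rewrite (@big_cat_nat _ _ _ T.+1) //= big_nat_cond.
  rewrite (eq_bigr (fun _ => 1%N)); last by move=> k /andP[/andP[_]]; rewrite ltnS => ->.
  rewrite -big_nat_cond sum_nat_const_nat subn1 muln1 /=.
  rewrite big1_seq ?addn0 // => k /andP[_]; rewrite mem_index_iota => /andP[kT _].
  by rewrite leqNgt kT.
move=> E; rewrite -(leq_add2r (\sum_(1 <= i < n.*2.+1) (n %/ p ^ i + n %/ p ^ i))).
rewrite -E -big_split /=; apply: leq_sum => k _.
have pk : (0 < p ^ k)%N by rewrite expn_gt0 prime_gt0.
case: (leqP k T) => kT.
  have := ltn_ceil n pk; have := leq_trunc_div n.*2 (p ^ k); nia.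
by rewrite divn_small // (leq_trans (trunc_log_ltn _ p1)) // leq_exp2l.
Qed.

(** Pascal's rule splits the next central coefficient into two coefficients, each at least the
    current central one. *)
Lemma central_bin_ge n : (2 ^ n <= 'C(n.*2, n))%N.
Proof.
elim: n => // n IH; rewrite doubleS binS.
have h : ('C(n.*2, n) <= 'C(n.*2.+1, n))%N by apply: leq_bin2l.
have h' : ('C(n.*2, n) <= 'C(n.*2.+1, n.+1))%N by rewrite binS leq_addl.
rewrite expnS; lia.
Qed.

(** Every prime factor of the central coefficient divides (2n)!, hence is at most 2n, and by
    [logn_central_bin] its full power is at most 2n too. *)
Lemma central_bin_le n : (0 < n)%N ->
  ('C(n.*2, n) <= n.*2 ^ size (primes_upto n.*2))%N.
Proof.
move=> n0.
have C0 : (0 < 'C(n.*2, n))%N by rewrite bin_gt0 -addnn leq_addr.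
have n20 : (0 < n.*2)%N by rewrite double_gt0.
rewrite {1}(prod_prime_decomp C0) prime_decompE big_map /=.
set s := primes _.
have ss : (size s <= size (primes_upto n.*2))%N.
  apply: uniq_leq_size (primes_uniq _) _ => p.
  rewrite mem_primes mem_primes_upto => /and3P[pp _ pd]; rewrite pp /=.
  rewrite leqNgt; apply/negP => lt.
  have: p %| (n.*2)`!.
    rewrite -(@bin_fact n.*2 n) ?dvdn_mulr //; rewrite -addnn leq_addr //.
  by rewrite -[p in p %| _]expn1 pfactor_dvdn ?fact_gt0 // logn_fact // big1_seq //
    => k /andP[_]; rewrite mem_index_iota => /andP[k1 _];
    apply: divn_small; apply: leq_trans lt _; rewrite -{1}(expn1 p) leq_exp2l // prime_gt1.
apply: leq_trans (_ : n.*2 ^ size s <= _)%N; last by rewrite leq_pexp2l.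
have: all (fun p => prime p) s by apply/allP => p; rewrite mem_primes => /andP[].
elim: s {ss} => [|p s IH] /=; first by rewrite big_nil.
case/andP => pp /IH h; rewrite big_cons expnS leq_mul //.
apply: leq_trans (_ : p ^ trunc_log p n.*2 <= _)%N.
  by rewrite leq_pexp2l ?prime_gt0 // logn_central_bin.
exact: trunc_logP (prime_gt1 pp) n20.
Qed.

(** At n = 2^(t-1) both bounds for the central coefficient are powers of 2, and their exponents are
    compared. *)
Lemma chebyshev_pow2 t : (0 < t)%N ->
  (2 ^ t.-1 <= t * size (primes_upto (2 ^ t)))%N.
Proof.
case: t => // t _ /=.
have n0 : (0 < 2 ^ t)%N by rewrite expn_gt0.
have := leq_trans (central_bin_ge (2 ^ t)) (central_bin_le _ n0).
by rewrite -mul2n -expnS -expnM leq_exp2l.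
Qed.

(** Makes sqrt X, the trivial count of the primes up to sqrt X, at most half of Chebyshev's
    bound. *)
Lemma ltn_add2_exp u : (4 <= u)%N -> (u + 2 <= 2 ^ u.-1)%N.
Proof.
elim: u => // u IH; rewrite leq_eqVlt => /orP[/eqP <- //|h].
have := IH h; case: u h {IH} => // u h; rewrite /= expnS; lia.
Qed.

(* For [X = 2 ^ 2 ^ u], the number [2 ^ (2 ^ u - u - e)] is [X / log X] up to a
   constant, and the primes are taken in [(sqrt X, X]]. *)
Lemma many_primes (d : nat) : exists e : nat, forall u : nat, (e + 4 <= u)%N ->
  exists ps : seq nat, [/\ uniq ps, size ps = (d * 2 ^ (2 ^ u - u - e))%N &
    forall p, p \in ps -> [/\ prime p, 2 ^ 2 ^ u.-1 < p & p <= 2 ^ 2 ^ u]%N].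
Proof.
(* With t = 2^u there are at least 2^(t-u-1) primes up to X. Removing those up to sqrt X leaves at
   least 2^(t-u-2), and d <= 2^d makes d * 2^(t-u-d-2) of them available. *)
exists d.+2 => u hu.
have u4 : (4 <= u)%N by lia.
have h1 := ltn_add2_exp u u4.
have E2 : (2 ^ u = 2 * 2 ^ u.-1)%N by rewrite -expnS prednK //; lia.
set t := (2 ^ u)%N.
have ue : (u + d.+2 <= t)%N.
  have h : (u < 2 ^ u.-1)%N by lia.
  rewrite /t; lia.
pose big := primes_upto (2 ^ t).
pose ps := [seq p <- big | 2 ^ 2 ^ u.-1 < p]%N.
have ubig : uniq big by rewrite filter_uniq // iota_uniq.
have c : (2 ^ (t - u - 1) <= size big)%N.
  have := chebyshev_pow2 t; rewrite expn_gt0 /= => /(_ isT).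
  rewrite {3}/t -[X in (X <= _)%N](_ : 2 ^ u * 2 ^ (t - u - 1) = _)%N.
    by rewrite leq_pmul2l // expn_gt0.
  by rewrite -expnD; congr (2 ^ _)%N; lia.
have sps : (size big <= size ps + 2 ^ 2 ^ u.-1)%N.
  rewrite /ps size_filter -[size big](count_predC (fun p => 2 ^ 2 ^ u.-1 < p)%N) leq_add2l.
  rewrite -size_filter; apply: leq_trans (_ : size (primes_upto (2 ^ 2 ^ u.-1)) <= _)%N.
    apply: uniq_leq_size; first by rewrite filter_uniq.
    by move=> p; rewrite mem_filter !mem_primes_upto /= -leqNgt => /and3P[-> ->].
  exact: size_primes_upto_le.
have c2 : (2 ^ 2 ^ u.-1 <= 2 ^ (t - u - 2))%N by rewrite leq_exp2l //; rewrite /t; lia.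
have c3 : (2 ^ (t - u - 1) = 2 ^ (t - u - 2) + 2 ^ (t - u - 2))%N.
  by rewrite addnn -mul2n -expnS; congr (2 ^ _)%N; lia.
have c4 : (d * 2 ^ (t - u - d.+2) <= 2 ^ (t - u - 2))%N.
  have -> : (t - u - 2 = d + (t - u - d.+2))%N by lia.
  by rewrite expnD leq_pmul2r ?expn_gt0 // ltnW // ltn_expl.
exists (take (d * 2 ^ (t - u - d.+2)) ps); split.
- by rewrite take_uniq // filter_uniq.
- rewrite size_takel //; lia.
- move=> p /mem_take; rewrite mem_filter mem_primes_upto => /and3P[-> -> ->] //.
Qed.

(** * Sums and the Hadamard matrix *)

Lemma RplusA : associative Rplus. Proof. by move=> x y z; rewrite Rplus_assoc. Qed.
Lemma RplusC : commutative Rplus. Proof. by move=> x y; rewrite Rplus_comm. Qed.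
Lemma Rplus0l : left_id 0 Rplus. Proof. exact: Rplus_0_l. Qed.
Lemma Rmult0l : left_zero 0 Rmult. Proof. exact: Rmult_0_l. Qed.
Lemma Rmult0r : right_zero 0 Rmult. Proof. exact: Rmult_0_r. Qed.
Lemma RmultDl : left_distributive Rmult Rplus. Proof. by move=> x y z; ring. Qed.
Lemma RmultDr : right_distributive Rmult Rplus. Proof. by move=> x y z; ring. Qed.
HB.instance Definition _ := Monoid.isComLaw.Build R 0 Rplus RplusA RplusC Rplus0l.
HB.instance Definition _ := Monoid.isMulLaw.Build R 0 Rmult Rmult0l Rmult0r.
HB.instance Definition _ := Monoid.isAddLaw.Build R Rmult Rplus RmultDl RmultDr.

Lemma CplusA : associative Cplus. Proof. exact: Cplus_assoc. Qed.
Lemma CplusC : commutative Cplus. Proof. exact: Cplus_comm. Qed.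
Lemma Cplus0l : left_id (RtoC 0) Cplus. Proof. exact: Cplus_0_l. Qed.
Lemma Cmult0l : left_zero (RtoC 0) Cmult. Proof. exact: Cmult_0_l. Qed.
Lemma Cmult0r : right_zero (RtoC 0) Cmult. Proof. exact: Cmult_0_r. Qed.
Lemma CmultDl : left_distributive Cmult Cplus.
Proof. by move=> x y z; rewrite Cmult_plus_distr_r. Qed.
Lemma CmultDr : right_distributive Cmult Cplus.
Proof. by move=> x y z; rewrite Cmult_plus_distr_l. Qed.
HB.instance Definition _ :=
  Monoid.isComLaw.Build C (RtoC 0) Cplus CplusA CplusC Cplus0l.
HB.instance Definition _ := Monoid.isMulLaw.Build C (RtoC 0) Cmult Cmult0l Cmult0r.
HB.instance Definition _ := Monoid.isAddLaw.Build C Cmult Cplus CmultDl CmultDr.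

Lemma rsum_ge0 (I : eqType) (r : seq I) (P : pred I) (F : I -> R) :
  (forall i, i \in r -> 0 <= F i) -> 0 <= \big[Rplus/0]_(i <- r | P i) F i.
Proof.
elim: r => [|i r IH] h; first by rewrite big_nil; lra.
have h1 := h i (mem_head _ _).
have h2 := IH (fun j hj => h j (mem_behead (s := i :: r) hj)).
by rewrite big_cons; case: ifP => _; lra.
Qed.

Lemma rsum_le (I : eqType) (r : seq I) (F G : I -> R) :
  (forall i, i \in r -> F i <= G i) ->
  \big[Rplus/0]_(i <- r) F i <= \big[Rplus/0]_(i <- r) G i.
Proof.
elim: r => [|i r IH] h; first by rewrite !big_nil; lra.
have h1 := h i (mem_head _ _).
have h2 := IH (fun j hj => h j (mem_behead (s := i :: r) hj)).
by rewrite !big_cons; lra.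
Qed.

Lemma rsum_const (I : Type) (r : seq I) (c : R) :
  \big[Rplus/0]_(i <- r) c = INR (size r) * c.
Proof.
elim: r => [|i r IH]; first by rewrite big_nil /=; lra.
by rewrite big_cons IH -[size (i :: r)]/((size r).+1) S_INR; ring.
Qed.

Lemma Cmod_csum (I : Type) (r : seq I) (P : pred I) (F : I -> C) :
  Cmod (\big[Cplus/RtoC 0]_(i <- r | P i) F i)
    <= \big[Rplus/0]_(i <- r | P i) Cmod (F i).
Proof.
elim/big_rec2: _ => [|i x y _ h]; first by rewrite Cmod_0; lra.
by have := Cmod_triangle (F i) y; lra.
Qed.

(** The squared modulus as a polynomial in the coordinates, so that [ring] proves identities such as
    the parallelogram law. *)
Definition csq (z : C) : R := fst z ^ 2 + snd z ^ 2.

Lemma csq_Cmod z : csq z = Cmod z ^ 2.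
Proof. by rewrite Cmod2_alt. Qed.

Lemma csq_ge0 z : 0 <= csq z.
Proof. by rewrite csq_Cmod; apply: pow2_ge_0. Qed.

Lemma csqM x y : csq (Cmult x y) = csq x * csq y.
Proof. rewrite /csq /=; ring. Qed.

Lemma csqD_le x y : csq (Cplus x y) <= 2 * (csq x + csq y).
Proof.
rewrite /csq /=.
have := pow2_ge_0 (fst x - fst y); have := pow2_ge_0 (snd x - snd y); lra.
Qed.

Lemma csqD4_le x y z t :
  csq (Cplus (Cplus x y) (Cplus z t)) <= 4 * (csq x + csq y + csq z + csq t).
Proof.
have := csqD_le (Cplus x y) (Cplus z t); have := csqD_le x y; have := csqD_le z t.
lra.
Qed.

Lemma Cmod_le_csq z x : 0 <= x -> csq z <= x ^ 2 -> Cmod z <= x.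
Proof. move=> x0; rewrite csq_Cmod => h; have := Cmod_ge_0 z; nra. Qed.

Lemma csq_le_Cmod z x : Cmod z <= x -> csq z <= x ^ 2.
Proof. move=> h; rewrite csq_Cmod; have := Cmod_ge_0 z; nra. Qed.

Definition sgn (b : bool) : C := if b then Copp (RtoC 1) else RtoC 1.

Lemma sgn_addb a b : sgn (a (+) b) = Cmult (sgn a) (sgn b).
Proof. by case: a; case: b; rewrite /sgn /=; ring. Qed.

Lemma csq_sgnM b z : csq (Cmult (sgn b) z) = csq z.
Proof. by rewrite csqM; case: b; rewrite /csq /=; ring. Qed.

Lemma Cmod_sgn b : Cmod (sgn b) = 1.
Proof. by case: b; rewrite /sgn ?Cmod_opp Cmod_1. Qed.

Lemma big_nat_double (T : Type) (idx : T) (op : Monoid.law idx) n (F : nat -> T) :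
  \big[op/idx]_(0 <= i < n.*2) F i =
  \big[op/idx]_(0 <= i < n) op (F i.*2) (F i.*2.+1).
Proof.
elim: n => [|n IH]; first by rewrite !big_geq.
by rewrite doubleS !big_nat_recr //= IH Monoid.mulmA.
Qed.

(* Sylvester's Hadamard matrix of order [2 ^ m], with [true] standing for [-1]. *)
Fixpoint had (m r s : nat) : bool :=
  if m is m'.+1 then had m' r./2 s./2 (+) (odd r && odd s) else false.

Definition hadT (m : nat) (v : nat -> C) (r : nat) : C :=
  \big[Cplus/RtoC 0]_(0 <= s < 2 ^ m) Cmult (sgn (had m r s)) (v s).

(** Vectors are functions on [nat] of which the first N values count; this is the squared Euclidean
    norm. *)
Definition sqn (N : nat) (v : nat -> C) : R :=
  \big[Rplus/0]_(0 <= i < N) csq (v i).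

Lemma INR_pow2 m : INR (2 ^ m) = 2 ^ m.
Proof. by elim: m => //= m IH; rewrite expnS mult_INR IH. Qed.

(** Induction along Sylvester's recursion: the even and odd rows are the smaller transform applied
    to the sums [vp] and the differences [vm] of neighbouring coordinates, and the parallelogram law
    adds the two norms. *)
Lemma hadT_isometry m v : sqn (2 ^ m) (hadT m v) = 2 ^ m * sqn (2 ^ m) v.
Proof.
rewrite /sqn; elim: m v => [|m IH] v.
  by rewrite expn0 !big_nat1 /hadT expn0 big_nat1 csq_sgnM /= Rmult_1_l.
rewrite expnS mul2n !big_nat_double /=.
pose vp i := Cplus (v i.*2) (v i.*2.+1).
pose vm i := Cplus (v i.*2) (Copp (v i.*2.+1)).
rewrite (eq_bigr (fun r => csq (hadT m vp r) + csq (hadT m vm r))); last first.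
  move=> r _; rewrite /hadT expnS mul2n !big_nat_double /=.
  congr (csq _ + csq _); apply: eq_bigr => s _.
    rewrite /= !uphalf_double !doubleK !odd_double !andbF !addbF /vp; ring.
  rewrite /= !uphalf_double !doubleK !odd_double /= addbF sgn_addb /vm.
  rewrite /sgn; ring.
rewrite big_split /= !IH !big_distrr -big_split /=.
by apply: eq_bigr => s _; rewrite /csq /=; ring.
Qed.

(** * Complex powers *)

Lemma CexpD z w : Cexp (Cplus z w) = Cmult (Cexp z) (Cexp w).
Proof.
case: z w => [a b] [c d]; rewrite /Cexp /Cmult /Cplus /Re /Im /=.
by rewrite exp_plus cos_plus sin_plus; congr pair; ring.
Qed.

Lemma Cmod_Cexp z : Cmod (Cexp z) = exp (Re z).
Proof.
have e0 := exp_pos (Re z).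
have h := sin2_cos2 (Im z); rewrite /Rsqr in h.
rewrite /Cmod /Cexp /=.
set c := cos _ in h *; set s := sin _ in h *.
rewrite (_ : _ + _ = exp (Re z) ^ 2 * (s * s + c * c)); last ring.
by rewrite h Rmult_1_r sqrt_pow2; lra.
Qed.

Lemma npowC_mul m n s : (0 < m)%N -> (0 < n)%N ->
  npowC (m * n) s = Cmult (npowC m s) (npowC n s).
Proof.
move=> m0 n0; rewrite /npowC -CexpD mult_INR ln_mult; try by apply: lt_0_INR; apply/ltP.
by rewrite RtoC_plus; congr Cexp; ring.
Qed.

Lemma Cmod_npowC n s : Cmod (npowC n s) = exp (- (Re s * ln (INR n))).
Proof. by rewrite Cmod_Cexp; congr exp; case: s => x y /=; rewrite /Re /=; ring. Qed.

Lemma ln_INR_ge0 n : 0 <= ln (INR n).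
Proof.
case: n => [|n]; last first.
  rewrite -ln_1; apply: ln_le; first lra.
  by rewrite S_INR; have := pos_INR n; lra.
(* At n = 0 the default value ln 0 = 0 applies. *)
by rewrite /= /ln; case: Rlt_dec => /= [h|_]; [exfalso|]; lra.
Qed.

Lemma exp_ge_1 x : 0 <= x -> 1 <= exp x.
Proof. by move=> h; have := exp_ineq1_le x; lra. Qed.

Lemma exp_mono x y : x <= y -> exp x <= exp y.
Proof. by case=> [h|->]; [left; apply: exp_increasing|right]. Qed.

Lemma Rabs_sin_le y : Rabs (sin y) <= Rabs y.
Proof.
have H x : 0 <= x -> Rabs (sin x) <= x.
  move=> x0; case: (Rle_dec x 1) => x1; last first.
    by have := SIN_bound x => hb; apply: Rabs_le; lra.
  case: (Req_dec x 0) => [->|xn]; first by rewrite sin_0 Rabs_R0; lra.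
  have x00 : 0 < x by lra.
  have := sin_lt_x x x00 => h.
  have := sin_ge_0 x x0; have := PI_4; have := PI2_1 => hp h4 hs.
  rewrite Rabs_right; first lra.
  by apply: Rle_ge; apply: hs; lra.
case: (Rle_dec 0 y) => hy; first by rewrite (Rabs_right y); [apply: H|]; lra.
rewrite -Rabs_Ropp -sin_neg (Rabs_left y); last lra.
by apply: H; lra.
Qed.

Lemma one_sub_cos y : 1 - cos y = 2 * sin (y / 2) ^ 2.
Proof.
rewrite {1}(_ : y = 2 * (y / 2)); last lra.
by rewrite cos_2a_sin; ring.
Qed.

Lemma Rabs_cos_sub1_le y : Rabs (cos y - 1) <= y ^ 2.
Proof.
rewrite -Rabs_Ropp Ropp_minus_distr one_sub_cos.
have h := Rabs_sin_le (y / 2).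
have h2 := Rsqr_le_abs_1 _ _ h; rewrite /Rsqr in h2.
rewrite Rabs_right; nra.
Qed.

Lemma MVT0 (f df : R -> R) x : (forall t, is_derive f t (df t)) ->
  exists2 c, Rabs c <= Rabs x & f x - f 0 = df c * x.
Proof.
move=> h; have [|t _|c [[c1 c2] e]] := MVT_gen f 0 x df.
- by move=> t _; apply: h.
- by apply: derivable_continuous_pt; exists (df t); apply/is_derive_Reals/h.
exists c; last by rewrite e; ring.
move: c1 c2; rewrite /Rmin /Rmax; case: Rle_dec => hx c1 c2.
  by rewrite !Rabs_right; lra.
by rewrite -(Rabs_Ropp c) -(Rabs_Ropp x) !Rabs_right; lra.
Qed.

Lemma Rabs_sin_subid_le y : Rabs (sin y - y) <= y ^ 2.
Proof.
have [|c hc] := @MVT0 (fun x => sin x - x) (fun x => cos x - 1) y.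
  by move=> t; auto_derive => //; ring.
rewrite sin_0 !Rminus_0_r => ->; rewrite Rabs_mult.
have : Rabs (cos c - 1) <= Rabs c.
  rewrite -Rabs_Ropp Ropp_minus_distr one_sub_cos Rabs_right; last nra.
  have := Rabs_sin_le (c / 2); rewrite Rabs_div; last lra.
  rewrite (Rabs_right 2); last lra.
  have := SIN_bound (c / 2) => hb; have : Rabs (sin (c / 2)) <= 1 by apply: Rabs_le; lra.
  rewrite -(pow2_abs (sin _)); have := Rabs_pos (sin (c / 2)); nra.
rewrite -(pow2_abs y); have := Rabs_pos c; nra.
Qed.

Lemma Rabs_exp_sub1_le x : Rabs (exp x - 1) <= Rabs x * exp (Rabs x).
Proof.
have [|c hc] := @MVT0 exp exp x; first by move=> t; auto_derive => //; ring.
rewrite exp_0 => ->; rewrite Rabs_mult (Rabs_right (exp c)); last first.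
  by have := exp_pos c; lra.
rewrite Rmult_comm; apply: Rmult_le_compat_l; first exact: Rabs_pos.
by apply: exp_mono; apply: Rle_trans (Rle_abs _) hc.
Qed.

Lemma Rabs_exp_sub1id_le x : Rabs (exp x - 1 - x) <= x ^ 2 * exp (Rabs x).
Proof.
have [|c hc] := @MVT0 (fun t => exp t - 1 - t) (fun t => exp t - 1) x.
  by move=> t; auto_derive => //; ring.
rewrite exp_0 (_ : 1 - 1 - 0 = 0) ?Rminus_0_r; last ring.
move=> ->; rewrite Rabs_mult -(pow2_abs x).
have := Rabs_exp_sub1_le c; have := Rabs_pos c; have := exp_pos (Rabs c).
have := exp_mono _ _ hc; have := Rabs_pos x => h1 h2 h3 h4 h5.
have : Rabs c * exp (Rabs c) <= Rabs x * exp (Rabs x).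
  apply: Rmult_le_compat; lra.
nra.
Qed.

Lemma Cmod_le_abs z : Cmod z <= Rabs (fst z) + Rabs (snd z).
Proof.
case: z => a b /=; rewrite (_ : (a, b) = Cplus (RtoC a) (Cmult Ci (RtoC b))).
  by apply: Rle_trans (Cmod_triangle _ _) _; rewrite Cmod_mult Cmod_Ci !Cmod_R; lra.
by rewrite /Cplus /Cmult /=; congr pair; ring.
Qed.

(** For w = x + iy the real part is (e^x - 1 - x) + e^x (cos y - 1) and the imaginary part (e^x - 1)
    sin y + (sin y - y). Each of these four summands is at most |w|^2 e^|w|. *)
Lemma Cmod_Cexp_sub1id_le w :
  Cmod (Cminus (Cminus (Cexp w) (RtoC 1)) w) <= 5 * Cmod w ^ 2 * exp (Cmod w).
Proof.
apply: Rle_trans (Cmod_le_abs _) _.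
have hx := re_le_Cmod w; have hy := Rle_trans _ _ _ (Rmax_r _ _) (Rmax_Cmod w).
rewrite /Re in hx.
case: w hx hy => x y /=; set M := Cmod _ => hx hy.
rewrite /Cexp /Re /Im /=.
have m0 : 0 <= M by apply: Cmod_ge_0.
have E1 : 1 <= exp M by apply: exp_ge_1.
have Ex := exp_mono _ _ hx.
have x0 := Rabs_pos x; have y0 := Rabs_pos y.
have ex0 := exp_pos x.
have Ex' : exp x <= exp M by apply: exp_mono; apply: Rle_trans (Rle_abs _) hx.
have h1 := Rabs_exp_sub1id_le x; have h2 := Rabs_cos_sub1_le y.
have h3 := Rabs_exp_sub1_le x; have h4 := Rabs_sin_le y.
have h5 := Rabs_sin_subid_le y.
have xM : x ^ 2 <= M ^ 2 by rewrite -(pow2_abs x); apply: pow_incr.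
have yM : y ^ 2 <= M ^ 2 by rewrite -(pow2_abs y); apply: pow_incr.
have M2 : 0 <= M ^ 2 by apply: pow2_ge_0.
have b1 : x ^ 2 * exp (Rabs x) <= M ^ 2 * exp M.
  by apply: Rmult_le_compat => //; [apply: pow2_ge_0|have := exp_pos (Rabs x); lra].
have b2 : exp x * Rabs (cos y - 1) <= M ^ 2 * exp M.
  rewrite Rmult_comm; apply: Rmult_le_compat; try lra; exact: Rabs_pos.
have b3 : Rabs (exp x - 1) * Rabs (sin y) <= M ^ 2 * exp M.
  have : Rabs (exp x - 1) <= M * exp M.
    by apply: Rle_trans h3 _; apply: Rmult_le_compat; try lra; have := exp_pos (Rabs x); lra.
  move=> h; rewrite (_ : M ^ 2 * exp M = M * exp M * M); last ring.
  by apply: Rmult_le_compat; try lra; exact: Rabs_pos.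
have b4 : Rabs (sin y - y) <= M ^ 2 * exp M.
  by have := Rmult_le_compat_l _ _ _ M2 E1; lra.
have c1 : Rabs (exp x * cos y + - 1 + - x) <= 2 * (M ^ 2 * exp M).
  rewrite (_ : _ + _ = (exp x - 1 - x) + exp x * (cos y - 1)); last ring.
  apply: Rle_trans (Rabs_triang _ _) _; rewrite Rabs_mult (Rabs_right (exp x)); lra.
have c2 : Rabs (exp x * sin y + - 0 + - y) <= 2 * (M ^ 2 * exp M).
  rewrite (_ : _ + _ = (exp x - 1) * sin y + (sin y - y)); last ring.
  apply: Rle_trans (Rabs_triang _ _) _; rewrite Rabs_mult; lra.
have : 0 <= M ^ 2 * exp M by nra.
move=> h6; apply: Rle_trans (Rplus_le_compat _ _ _ _ c1 c2) _; lra.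
Qed.

(** * Derivative and Taylor remainder of n^-s, uniformly in n *)

Definition dnpowC (n : nat) (s : C) : C :=
  Copp (Cmult (RtoC (ln (INR n))) (npowC n s)).

(** Differentiability is expressed by bounds on this remainder, [g] being the derivative: they pass
    through sums, products and series by algebra alone. *)
Definition taylor_rem (f g : C -> C) (s h : C) : C :=
  Cminus (Cminus (f (Cplus s h)) (f s)) (Cmult h (g s)).

(** The square of 80 / delta^2, where 80 = 5 * 16 arises in [csq_npowC_rem_le]. *)
Definition npow_const (delta : R) : R := 6400 * (/ delta) ^ 4.

Lemma npow_const_ge1 delta : 0 < delta <= 1 -> 1 <= npow_const delta.
Proof.
move=> [d0 d1]; rewrite /npow_const.
have h : 1 <= / delta by rewrite -Rinv_1; apply: Rinv_le_contravar.
have := pow_R1_Rle _ 4 h; lra.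
Qed.

Lemma csq_npowC_le1 n s : 0 <= Re s -> csq (npowC n s) <= 1.
Proof.
move=> h; rewrite -(pow1 2); apply: csq_le_Cmod; rewrite Cmod_npowC -exp_0.
apply: exp_mono; have := ln_INR_ge0 n; nra.
Qed.

(** With L = log n this trades a factor log n for n^a / a. *)
Lemma id_le_exp_scaled a L : 0 < a -> 0 <= L -> L <= / a * exp (a * L).
Proof.
move=> a0 L0; have := exp_ineq1_le (a * L) => h.
apply: (Rmult_le_reg_l a) => //; rewrite -Rmult_assoc Rinv_r; lra.
Qed.

(** Here log n <= n^delta / delta, and n^delta is absorbed by n^(-Re s). *)
Lemma csq_dnpowC_le delta n s : 0 < delta <= 1 -> delta <= Re s ->
  csq (dnpowC n s) <= npow_const delta.
Proof.
move=> [d0 d1] ds.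
have L0 := ln_INR_ge0 n; set L := ln _ in L0.
apply: (Rle_trans _ ((/ delta) ^ 2)); last first.
  have h : 1 <= / delta by rewrite -Rinv_1; apply: Rinv_le_contravar.
  rewrite /npow_const; have := pow_R1_Rle _ 2 h; nra.
apply: csq_le_Cmod; rewrite Cmod_opp Cmod_mult Cmod_npowC Cmod_R Rabs_right -/L; last lra.
have h1 := id_le_exp_scaled _ _ d0 L0.
have h2 : exp (- (Re s * L)) <= exp (- (delta * L)) by apply: exp_mono; nra.
have i0 : 0 < / delta by apply: Rinv_0_lt_compat.
apply: (Rle_trans _ (/ delta * exp (delta * L) * exp (- (delta * L)))).
  apply: Rmult_le_compat => //; have := exp_pos (- (Re s * L)); lra.
rewrite Rmult_assoc -exp_plus Rplus_opp_r exp_0; lra.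
Qed.

(** Factoring out n^-s leaves e^w - 1 - w with w = - h log n. The square of log n costs n^(delta/2)
    and e^|w| another n^(delta/2); together they are absorbed by n^(-Re s). *)
Lemma csq_npowC_rem_le delta n s h :
  0 < delta <= 1 -> delta <= Re s -> Cmod h <= delta / 2 ->
  csq (taylor_rem (npowC n) (dnpowC n) s h) <= npow_const delta * Cmod h ^ 4.
Proof.
move=> [d0 d1] ds hh.
have L0 := ln_INR_ge0 n; set L := ln (INR n) in L0.
set w := Copp (Cmult h (RtoC L)).
have -> : taylor_rem (npowC n) (dnpowC n) s h =
    Cmult (npowC n s) (Cminus (Cminus (Cexp w) (RtoC 1)) w).
  rewrite /taylor_rem /dnpowC {1}/npowC -/L.
  rewrite (_ : Copp (Cmult (Cplus s h) (RtoC L)) = Cplus (Copp (Cmult s (RtoC L))) w).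
    by rewrite CexpD /npowC -/L /w; ring.
  by rewrite /w; ring.
have i0 : 0 < / delta by apply: Rinv_0_lt_compat.
have -> : npow_const delta * Cmod h ^ 4 = (80 * (/ delta) ^ 2 * Cmod h ^ 2) ^ 2.
  by rewrite /npow_const; ring.
apply: csq_le_Cmod; rewrite Cmod_mult Cmod_npowC -/L.
have h0 := Cmod_ge_0 h.
have wE : Cmod w = Cmod h * L by rewrite Cmod_opp Cmod_mult Cmod_R Rabs_right //; lra.
have b := Cmod_Cexp_sub1id_le w; rewrite wE in b.
have d4 : 0 < delta / 4 by lra.
have h1 := id_le_exp_scaled _ _ d4 L0.
have e1 := exp_pos (delta / 4 * L); set e := exp (delta / 4 * L) in h1 e1.
have LL : L ^ 2 <= 16 * (/ delta) ^ 2 * (e * e).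
  apply: Rle_trans (pow_incr _ _ 2 (conj L0 h1)) _; right.
  by field; lra.
have E2 : exp (- (Re s * L)) * (exp (Cmod h * L) * (e * e)) <= 1.
  rewrite -!exp_plus -exp_0; apply: exp_mono.
  have : Cmod h * L <= delta / 2 * L by apply: Rmult_le_compat_r.
  have : delta * L <= Re s * L by apply: Rmult_le_compat_r.
  lra.
have es := exp_pos (- (Re s * L)); have eh := exp_pos (Cmod h * L).
apply: (Rle_trans _ (exp (- (Re s * L)) *
   (5 * (Cmod h ^ 2 * (16 * (/ delta) ^ 2 * (e * e))) * exp (Cmod h * L)))).
  apply: Rmult_le_compat_l; first lra.
  apply: Rle_trans b _; apply: Rmult_le_compat_r; first lra.
  rewrite Rpow_mult_distr; apply: Rmult_le_compat_l; first lra.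
  by apply: Rmult_le_compat_l => //; apply: pow2_ge_0.
have c0 : 0 <= 80 * (/ delta) ^ 2 * Cmod h ^ 2.
  by have := pow2_ge_0 (Cmod h); have := pow2_ge_0 (/ delta) => ? ?; nra.
have := Rmult_le_compat_l _ _ _ c0 E2; rewrite /=; lra.
Qed.

(** Every term carries h^2 or a remainder of one factor, and outside the remainders only [f], later
    a prime power p^-s, is evaluated at s + h. *)
Lemma taylor_rem_mul (f f' g g' : C -> C) s h :
  taylor_rem (fun s => Cmult (f s) (g s))
    (fun s => Cplus (Cmult (f' s) (g s)) (Cmult (f s) (g' s))) s h =
  Cplus (Cplus (Cmult (f (Cplus s h)) (taylor_rem g g' s h))
               (Cmult (Cmult h h) (Cmult (f' s) (g' s))))
        (Cplus (Cmult (taylor_rem f f' s h) (g s))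
               (Cmult h (Cmult (taylor_rem f f' s h) (g' s)))).
Proof. by rewrite /taylor_rem; ring. Qed.

Lemma taylor_rem_hadT m (f g : C -> nat -> C) s h r :
  taylor_rem (fun s => hadT m (f s) r) (fun s => hadT m (g s) r) s h =
  hadT m (fun i => taylor_rem (fun s => f s i) (fun s => g s i) s h) r.
Proof.
rewrite /taylor_rem /hadT; elim: (index_iota _ _) => [|i l IH].
  by rewrite !big_nil; ring.
by rewrite !big_cons -IH; ring.
Qed.

(** * Polynomials of small sup norm *)

Fixpoint poly_val (q : nat -> nat -> nat) (m j : nat) (s : C) (r : nat) : C :=
  if j is j'.+1 then
    hadT m (fun i => Cmult (npowC (q j' i) s) (poly_val q m j' s i)) r
  else RtoC 1.

(** The recursion of [poly_val] differentiated formally by the product rule; [sqn_poly_rem] shows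
    that this is the derivative. *)
Fixpoint poly_der (q : nat -> nat -> nat) (m j : nat) (s : C) (r : nat) : C :=
  if j is j'.+1 then
    hadT m (fun i => Cplus (Cmult (dnpowC (q j' i) s) (poly_val q m j' s i))
                           (Cmult (npowC (q j' i) s) (poly_der q m j' s i))) r
  else RtoC 0.

Lemma poly_valS q m j s : poly_val q m j.+1 s =
  hadT m (fun i => Cmult (npowC (q j i) s) (poly_val q m j s i)).
Proof. by []. Qed.

Lemma poly_derS q m j s : poly_der q m j.+1 s =
  hadT m (fun i => Cplus (Cmult (dnpowC (q j i) s) (poly_val q m j s i))
                         (Cmult (npowC (q j i) s) (poly_der q m j s i))).
Proof. by []. Qed.

Arguments poly_val : simpl never.
Arguments poly_der : simpl never.

Lemma sqn_le N v (c : R) (u : nat -> C) :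
  (forall i, csq (v i) <= c * csq (u i)) -> sqn N v <= c * sqn N u.
Proof. by move=> h; rewrite /sqn big_distrr /=; apply: rsum_le. Qed.

Lemma pow2_pos m : 0 < 2 ^ m.
Proof. by apply: pow_lt; lra. Qed.

(** The all-ones vector has squared norm 2^m. In each stage the factors p^-s have modulus at most 1
    and the Hadamard matrix multiplies the squared norm by 2^m. *)
Lemma sqn_poly_val q m j s : 0 <= Re s ->
  sqn (2 ^ m) (poly_val q m j s) <= (2 ^ m) ^ j.+1.
Proof.
move=> s0; have p0 := pow2_pos m.
elim: j => [|j IH].
  rewrite /sqn (eq_bigr (fun _ => 1)); last by move=> i _; rewrite /csq /=; ring.
  by rewrite rsum_const size_iota subn0 INR_pow2 pow_1; lra.
rewrite poly_valS hadT_isometry -[X in _ <= X]/(2 ^ m * (2 ^ m) ^ j.+1).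
apply: Rmult_le_compat_l; first lra.
apply: Rle_trans IH; rewrite -[X in _ <= X]Rmult_1_l; apply: sqn_le => i.
rewrite csqM; apply: Rmult_le_compat_r; first exact: csq_ge0.
exact: csq_npowC_le1.
Qed.

(** The recursion is dictated by the four terms of [taylor_rem_mul] and the factor 4 of [csqD4_le];
    it also dominates what the derivative requires. *)
Fixpoint poly_const (delta : R) (j : nat) : R :=
  if j is j'.+1 then
    4 * (poly_const delta j' + 2 * npow_const delta * poly_const delta j'
         + npow_const delta)
  else 0.

Lemma poly_const_ge0 delta j : 0 < delta <= 1 -> 0 <= poly_const delta j.
Proof.
move=> h; have k := npow_const_ge1 _ h; elim: j => /= [|j IH]; first lra.
by nra.
Qed.

Lemma sqn_poly_der delta q m j s : 0 < delta <= 1 -> delta <= Re s ->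
  sqn (2 ^ m) (poly_der q m j s) <= poly_const delta j * (2 ^ m) ^ j.+1.
Proof.
move=> hd ds; have p0 := pow2_pos m.
have K1 := npow_const_ge1 _ hd; set K := npow_const delta in K1.
elim: j => [|j IH].
  rewrite /sqn (eq_bigr (fun _ => 0)); last by move=> i _; rewrite /csq /=; ring.
  by rewrite rsum_const /=; lra.
have hE := sqn_poly_val q m j s (Rle_trans _ _ _ (Rlt_le _ _ hd.1) ds).
have k0 := poly_const_ge0 delta j hd.
rewrite poly_derS hadT_isometry -[(2 ^ m) ^ j.+2]/(2 ^ m * (2 ^ m) ^ j.+1).
set M := (2 ^ m) ^ j.+1 in IH hE *.
have M0 : 0 < M by apply: pow_lt.
rewrite (_ : poly_const delta j.+1 * _ = 2 ^ m * (poly_const delta j.+1 * M)); last ring.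
apply: Rmult_le_compat_l; first lra.
apply: (Rle_trans _ (2 * (K * sqn (2 ^ m) (poly_val q m j s) + sqn (2 ^ m) (poly_der q m j s)))).
  rewrite /sqn big_distrr -big_split big_distrr /=; apply: rsum_le => i _.
  apply: Rle_trans (csqD_le _ _) _; rewrite !csqM.
  have a1 := csq_npowC_le1 (q j i) s (Rle_trans _ _ _ (Rlt_le _ _ hd.1) ds).
  have a2 := csq_dnpowC_le _ (q j i) _ hd ds; rewrite -/K in a2.
  have := Rmult_le_compat_r _ _ _ (csq_ge0 (poly_val q m j s i)) a2.
  have := Rmult_le_compat_r _ _ _ (csq_ge0 (poly_der q m j s i)) a1.
  lra.
rewrite [poly_const delta j.+1]/= -/K.
have := Rmult_le_compat_l K _ _ ltac:(lra) hE.
have := Rmult_le_pos _ _ k0 (Rlt_le _ _ M0).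
have : 0 <= K * M by nra.
have : 0 <= K * poly_const delta j * M by apply: Rmult_le_pos; nra.
lra.
Qed.

Lemma csq_scale_le c x y : 0 <= y -> csq c <= y -> csq (Cmult c x) <= y * csq x.
Proof. by move=> y0 h; rewrite csqM; apply: Rmult_le_compat_r => //; apply: csq_ge0. Qed.

(** The remainder commutes with the linear map [hadT], so the isometry reduces each stage to
    [taylor_rem_mul] in every coordinate. *)
Lemma sqn_poly_rem delta q m j s h : 0 < delta <= 1 -> delta <= Re s ->
  Cmod h <= delta / 2 ->
  sqn (2 ^ m) (fun r => taylor_rem (fun s => poly_val q m j s r)
                                   (fun s => poly_der q m j s r) s h)
    <= poly_const delta j * (2 ^ m) ^ j.+1 * Cmod h ^ 4.
Proof.
move=> hd ds hh; have p0 := pow2_pos m.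
have K1 := npow_const_ge1 _ hd; set K := npow_const delta in K1.
elim: j => [|j IH].
  rewrite /sqn (eq_bigr (fun _ => 0)).
    by rewrite rsum_const /=; lra.
  by move=> i _; rewrite /taylor_rem /csq /=; ring.
have sp : 0 <= Re s by lra.
have hE := sqn_poly_val q m j s sp.
have hD := sqn_poly_der delta q m j s hd ds.
have k0 := poly_const_ge0 delta j hd.
rewrite /sqn (eq_bigr _ (fun r _ => congr1 csq (taylor_rem_hadT m
  (fun s i => Cmult (npowC (q j i) s) (poly_val q m j s i))
  (fun s i => Cplus (Cmult (dnpowC (q j i) s) (poly_val q m j s i))
                    (Cmult (npowC (q j i) s) (poly_der q m j s i))) s h r))).
rewrite -/(sqn _ _) hadT_isometry -[(2 ^ m) ^ j.+2]/(2 ^ m * (2 ^ m) ^ j.+1).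
set M := (2 ^ m) ^ j.+1 in IH hE hD *.
have M0 : 0 < M by apply: pow_lt.
set k := poly_const delta j in IH hD k0.
have h0 := Cmod_ge_0 h; set t := Cmod h in IH hh h0 *.
have t4 : 0 <= t ^ 4 by apply: pow_le.
rewrite (_ : poly_const delta j.+1 * _ * _ =
             2 ^ m * (poly_const delta j.+1 * M * t ^ 4)); last ring.
apply: Rmult_le_compat_l; first lra.
apply: (Rle_trans _ (4 *
   (sqn (2 ^ m) (fun i => taylor_rem (fun s => poly_val q m j s i) (fun s => poly_der q m j s i) s h)
    + t ^ 4 * K * sqn (2 ^ m) (poly_der q m j s)
    + K * t ^ 4 * sqn (2 ^ m) (poly_val q m j s)
    + K * t ^ 4 * sqn (2 ^ m) (poly_der q m j s)))).
  rewrite /sqn !big_distrr -!big_split big_distrr /=; apply: rsum_le => i _.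
  rewrite taylor_rem_mul; apply: Rle_trans (csqD4_le _ _ _ _) _.
  apply: Rmult_le_compat_l; first lra.
  (* As |h| <= delta/2, the point s + h stays in the right half-plane. *)
  have a1 : csq (npowC (q j i) (Cplus s h)) <= 1.
    apply: csq_npowC_le1; have := re_le_Cmod h; have := Rabs_maj2 (Re h).
    rewrite -/t (_ : Re (Cplus s h) = Re s + Re h) //; case: hd; lra.
  have a2 := csq_dnpowC_le _ (q j i) _ hd ds; rewrite -/K in a2.
  have a3 := csq_npowC_rem_le _ (q j i) _ _ hd ds hh; rewrite -/K -/t in a3.
  have ht : csq h = t ^ 2 by rewrite csq_Cmod.
  (* Used to drop the extra factor h in the fourth term. *)
  have b3 : csq h <= 1 by rewrite ht; case: hd; nra.
  have kt : 0 <= K * t ^ 4 by nra.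
  apply: Rplus_le_compat; first apply: Rplus_le_compat; first apply: Rplus_le_compat.
  - by have := csq_scale_le _ (taylor_rem (fun s => poly_val q m j s i)
        (fun s => poly_der q m j s i) s h) _ Rle_0_1 a1; rewrite Rmult_1_l.
  - rewrite !csqM ht (_ : t ^ 2 * t ^ 2 = t ^ 4); last ring.
    rewrite Rmult_assoc; apply: Rmult_le_compat_l => //.
    by apply: Rmult_le_compat_r => //; apply: csq_ge0.
  - exact: csq_scale_le.
  - rewrite csqM -[X in _ <= X]Rmult_1_l.
    apply: Rmult_le_compat => //; try exact: csq_ge0.
    exact: csq_scale_le.
rewrite [poly_const delta j.+1]/= -/K -/k.
have kt : 0 <= K * t ^ 4 by nra.
have := Rmult_le_compat_l (K * t ^ 4) _ _ kt hE.
have := Rmult_le_compat_l (K * t ^ 4) _ _ kt hD.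
lra.
Qed.

Lemma csq0_le_sqn m (f : nat -> C) : csq (f 0%N) <= sqn (2 ^ m) f.
Proof.
rewrite /sqn big_ltn ?expn_gt0 // -[X in X <= _]Rplus_0_r.
apply: Rplus_le_compat_l; apply: rsum_ge0 => i _; exact: csq_ge0.
Qed.

(** * Monomials and coefficients *)

(** A common index set for n and p * n, over which [logn] is additive term by term. *)
Lemma Omega_primes_upto n B : (0 < n <= B)%N ->
  Omega n = (\sum_(p <- primes_upto B) logn p n)%N.
Proof.
case/andP=> n0 nB; rewrite /Omega [RHS](bigID (mem (primes n))) /=.
rewrite [X in (_ + X)%N]big1 ?addn0.
  rewrite -[RHS]big_filter; apply: perm_big; apply: uniq_perm.
  - exact: primes_uniq.
  - by rewrite !filter_uniq // iota_uniq.
  move=> p; rewrite mem_filter mem_primes_upto /=; case hp: (p \in primes n) => //.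
  move: hp; rewrite mem_primes => /and3P[-> _ pn].
  by rewrite (leq_trans (dvdn_leq n0 pn) nB).
by move=> p; rewrite -logn_gt0 -leqNgt leqn0 => /eqP.
Qed.

Lemma Omega_prime_mul p n : prime p -> (0 < n)%N ->
  (Omega (p * n) <= (Omega n).+1)%N.
Proof.
move=> pp n0; have p0 := prime_gt0 pp.
rewrite !(@Omega_primes_upto _ (p * n)) ?muln_gt0 ?p0 ?n0 ?leqnn ?leq_pmull //.
rewrite (eq_bigr (fun r => (r == p) + logn r n)%N); last first.
  by move=> r _; rewrite lognM // logn_prime // eq_sym.
rewrite big_split /= -addn1 addnC leq_add2l -big_mkcond /= sum1_count.
by rewrite -/(count_mem p _) count_uniq_mem ?leq_b1 // filter_uniq // iota_uniq.
Qed.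

(* The monomials of [poly_val]: [(n, b)] stands for [sgn b * n ^ - s]. *)
Fixpoint words (q : nat -> nat -> nat) (m j r : nat) : seq (nat * bool) :=
  if j is j'.+1 then
    [seq ((q j' i * x.1)%N, had m r i (+) x.2)
       | i <- index_iota 0 (2 ^ m), x <- words q m j' i]
  else [:: (1%N, false)].

Lemma words_gt0 q m j r x : (forall j i, 0 < q j i)%N ->
  x \in words q m j r -> (0 < x.1)%N.
Proof.
move=> q0; elim: j r x => [|j IH] r x /=; first by rewrite inE => /eqP ->.
by case/allpairsPdep => i [y [_ hy ->]] /=; rewrite muln_gt0 q0 (IH _ _ hy).
Qed.

Lemma npowC1 s : npowC 1 s = RtoC 1.
Proof.
rewrite /npowC ln_1 Cmult_0_r -RtoC_opp Ropp_0 /Cexp /Re /Im /RtoC.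
by cbn [fst snd]; rewrite exp_0 cos_0 sin_0; congr pair; ring.
Qed.

Lemma poly_val_words q m j s r : (forall j i, 0 < q j i)%N ->
  poly_val q m j s r =
  \big[Cplus/RtoC 0]_(x <- words q m j r) Cmult (sgn x.2) (npowC x.1 s).
Proof.
move=> q0; elim: j r => [|j IH] r.
  by rewrite big_seq1 /= npowC1 Cmult_1_r.
rewrite poly_valS /hadT /= big_allpairs_dep; apply: eq_bigr => i _.
rewrite IH !big_distrr /=; apply: eq_big_seq => x hx.
by rewrite sgn_addb npowC_mul ?q0 ?(words_gt0 _ _ _ _ _ q0 hx) //; ring.
Qed.

Lemma size_words q m j r : size (words q m j r) = ((2 ^ m) ^ j)%N.
Proof.
elim: j r => [|j IH] r //=; rewrite size_allpairs_dep.
rewrite (eq_map (g := fun _ => (2 ^ m) ^ j)%N) // sumnE big_map.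
by rewrite big_const_seq iter_addn_0 count_predT size_iota subn0 expnS mulnC.
Qed.

(** The last clause, that only primes of earlier stages divide a word, drives [words_uniq]. *)
Lemma words_spec (q : nat -> nat -> nat) (m d Y X : nat) :
  (forall j i, (j < d)%N -> (i < 2 ^ m)%N -> [/\ prime (q j i), Y < q j i & q j i <= X]%N) ->
  forall j r x, (j <= d)%N -> x \in words q m j r ->
  [/\ (0 < x.1)%N, (Y ^ j <= x.1 <= X ^ j)%N, (Omega x.1 <= j)%N &
    forall p, prime p -> p %| x.1 ->
      exists j' i', [/\ (j' < j)%N, (i' < 2 ^ m)%N & p = q j' i']].
Proof.
move=> hq; elim=> [|j IH] r x jd /=.
  rewrite inE => /eqP -> /=; split=> //; first by rewrite /Omega big_nil.
  by move=> p pp; rewrite dvdn1 => /eqP p1; rewrite p1 in pp.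
case/allpairsPdep => i [y [hi hy ->]] /=.
rewrite mem_index_iota /= in hi.
have [y0 /andP[y1 y2] yO yp] := IH _ _ (ltnW jd) hy.
have [pq q1 q2] := hq _ _ jd hi.
split.
- by rewrite muln_gt0 prime_gt0.
- by rewrite !expnS !leq_mul // ltnW.
- exact: leq_trans (Omega_prime_mul _ _ pq y0) _.
move=> p pp; rewrite Euclid_dvdM // => /orP[|/(yp _ pp)].
  by rewrite dvdn_prime2 // => /eqP ->; exists j, i.
by case=> j' [i' [h1 h2 h3]]; exists j', i'; split=> //; apply: ltnW.
Qed.

(** Unique factorization: the integer determines the prime of the last stage, since that is its only
    prime divisor from this stage; cancelling it leaves a shorter word. *)
Lemma words_uniq (q : nat -> nat -> nat) (m d Y X : nat) :
  (forall j i, (j < d)%N -> (i < 2 ^ m)%N -> [/\ prime (q j i), Y < q j i & q j i <= X]%N) ->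
  (forall j i j' i', (j < d)%N -> (i < 2 ^ m)%N -> (j' < d)%N -> (i' < 2 ^ m)%N ->
     q j i = q j' i' -> j = j' /\ i = i') ->
  forall j r, (j <= d)%N -> uniq [seq x.1 | x <- words q m j r].
Proof.
move=> hq hinj; elim=> [|j IH] r jd //=.
rewrite map_allpairs /=.
rewrite -(@allpairs_mapr _ _ _ _ (fun i n => q j i * n)%N (fun _ x => x.1)).
apply: allpairs_uniq_dep; first exact: iota_uniq.
  by move=> i _; apply: IH; apply: ltnW.
have qd i y : (i < 2 ^ m)%N -> y \in words q m j i -> forall i', (i' < 2 ^ m)%N ->
    q j i' %| q j i * y.1 -> i = i'.
  move=> hi hy i' hi'; have [_ _ _ yp] := words_spec _ _ _ _ _ hq _ _ _ (ltnW jd) hy.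
  have [pq _ _] := hq _ _ jd hi; have [pq' _ _] := hq _ _ jd hi'.
  rewrite Euclid_dvdM // dvdn_prime2 // => /orP[/eqP e|/(yp _ pq')].
    by case: (hinj _ _ _ _ jd hi' jd hi e).
  case=> j' [k [h1 h2 h3]].
  have [e _] := hinj _ _ _ _ jd hi' (ltn_trans h1 jd) h2 h3.
  by rewrite e ltnn in h1.
move=> [i n] [i' n'] /allpairsPdep[i1 [n1 [hi1 hn1 [e1 e2]]]].
move=> /allpairsPdep[i2 [n2 [hi2 hn2 [e3 e4]]]] /=.
subst i1 i2; move: e2 e4 hn1 hn2 => /= <- <- {n1 n2}.
rewrite !mem_index_iota /= in hi1 hi2 *.
case/mapP => x hx ->; case/mapP => y hy -> e.
have ei : i = i' by apply: (qd _ _ hi1 hx) => //; rewrite e dvdn_mulr.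
subst i'; congr (Tagged _ _); apply/eqP.
have [pq _ _] := hq _ _ jd hi1.
by rewrite -(@eqn_pmul2l (q j i)) ?prime_gt0 // e.
Qed.

Definition coef (w : seq (nat * bool)) (n : nat) : C :=
  \big[Cplus/RtoC 0]_(x <- w | x.1 == n) sgn x.2.

Lemma coef_notin w n : n \notin [seq x.1 | x <- w] -> coef w n = RtoC 0.
Proof.
move=> h; rewrite /coef big1_seq // => x /andP[/eqP e hx].
by rewrite -e map_f in h.
Qed.

Lemma coef_mem w x : uniq [seq x.1 | x <- w] -> x \in w -> coef w x.1 = sgn x.2.
Proof.
move=> u hx; rewrite /coef -big_filter.
suff -> : [seq y <- w | y.1 == x.1] = [:: x] by rewrite big_seq1.
elim: w u hx => //= y w IH /andP[yw u]; rewrite inE => /orP[/eqP e|hx].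
  subst y; rewrite eqxx; congr cons; apply/eqP; rewrite -[_ == _]negbK -has_filter.
  by apply/negP => /hasP[z hz /eqP ez]; rewrite -ez map_f in yw.
rewrite ifN ?IH //; apply/eqP => e.
by rewrite e map_f in yw.
Qed.

Lemma Cmod_coef_le1 w n : uniq [seq x.1 | x <- w] -> Cmod (coef w n) <= 1.
Proof.
move=> u; case: (boolP (n \in [seq x.1 | x <- w])) => [/mapP[x hx ->]|h].
  by rewrite coef_mem // Cmod_sgn; lra.
by rewrite coef_notin // Cmod_0; lra.
Qed.

Lemma csum_coef (w : seq (nat * bool)) (s : seq nat) (f : nat -> C) :
  uniq s -> {subset [seq x.1 | x <- w] <= s} ->
  \big[Cplus/RtoC 0]_(n <- s) Cmult (coef w n) (f n) =
  \big[Cplus/RtoC 0]_(x <- w) Cmult (sgn x.2) (f x.1).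
Proof.
move=> us ws.
under eq_bigr => n _ do rewrite /coef big_distrl big_mkcond /=.
rewrite exchange_big /=; apply: eq_big_seq => x hx.
rewrite (bigD1_seq x.1) ?ws ?map_f //= eqxx big1 ?Monoid.mulm1 //.
by move=> n; rewrite eq_sym => /negbTE ->.
Qed.

(** Distinct integers exclude cancellation, so each word contributes a coefficient of modulus 1. *)
Lemma rsum_coef (w : seq (nat * bool)) (s : seq nat) (f : nat -> R) :
  uniq [seq x.1 | x <- w] -> uniq s -> {subset [seq x.1 | x <- w] <= s} ->
  \big[Rplus/0]_(n <- s) (Cmod (coef w n) * f n) = \big[Rplus/0]_(x <- w) f x.1.
Proof.
move=> uw us ws.
rewrite (bigID (mem [seq x.1 | x <- w])) /= [X in _ + X]big1; last first.
  by move=> n h; rewrite coef_notin // Cmod_0; ring.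
rewrite Rplus_0_r -big_filter (perm_big [seq x.1 | x <- w]).
  rewrite big_map; apply: eq_big_seq => x hx.
  by rewrite coef_mem // Cmod_sgn; ring.
apply: uniq_perm => //; first exact: filter_uniq.
by move=> n; rewrite mem_filter /= andb_idr //; apply: ws.
Qed.

(** * One block *)

Definition weight (d : nat) (alpha : R) (n : nat) : R :=
  Rpower (INR n) (- sigma_crit d) * powR0 (ln (INR n)) alpha.

(** As [poly_const] bounds squares, 1 + x >= sqrt x gives a bound for moduli. *)
Definition block_const (d : nat) (delta : R) : R := 1 + poly_const delta d.

(** What the gliding hump asks of one polynomial [P] with derivative [D]. Apart from eps, the bounds
    depend only on d and delta, so they are summable over blocks with eps = 2^-k. *)
Definition is_block (d : nat) (alpha : R) (L : nat) (eps : R)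
    (U : nat) (b : nat -> C) (P D : C -> C) : Prop :=
  [/\ (L < U)%N,
    (forall n, b n <> RtoC 0 -> [/\ (L < n)%N, (n <= U)%N & (Omega n <= d)%N]),
    (forall n, Cmod (b n) <= eps) /\
    (forall s, 0 < Re s -> Cmod (P s) <= eps),
    (forall M s, (U <= M)%N ->
      \big[Cplus/RtoC 0]_(1 <= n < M.+1) Cmult (b n) (npowC n s) = P s) &
    (forall delta s, 0 < delta <= 1 -> delta <= Re s ->
      Cmod (D s) <= eps * block_const d delta /\
      (forall h, Cmod h <= delta / 2 ->
        Cmod (taylor_rem P D s h) <= eps * block_const d delta * Cmod h ^ 2)) /\
    1 <= \big[Rplus/0]_(L.+1 <= n < U.+1) (Cmod (b n) * weight d alpha n)].

Lemma INR_expn a k : INR (a ^ k) = INR a ^ k.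
Proof. by elim: k => //= k IH; rewrite expnS mult_INR IH. Qed.

Lemma exp_mul_nat x n : exp (INR n * x) = exp x ^ n.
Proof.
elim: n => [|n IH]; first by rewrite Rmult_0_l exp_0.
by rewrite S_INR Rmult_plus_distr_r Rmult_1_l exp_plus IH /=; ring.
Qed.

Lemma ln_INR_expn2 k : ln (INR (2 ^ k)) = INR k * ln 2.
Proof. by rewrite INR_pow2 ln_pow //; lra. Qed.

Lemma ln2_pos : 0 < ln 2.
Proof. by rewrite -ln_1; apply: ln_increasing; lra. Qed.

(** The power of n is bounded at n = X^d, where d * sigma_d = (d-1)/2, and the logarithm by log n >=
    (log X)/2. The exponential form reduces the final estimate to a linear inequality in u. *)
Lemma weight_ge d alpha n u : (1 <= d)%N -> 0 < alpha -> (1 <= u)%N ->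
  ((2 ^ 2 ^ u.-1) ^ d <= n <= (2 ^ 2 ^ u) ^ d)%N ->
  exp (- ((INR d - 1) / 2) * (INR (2 ^ u) * ln 2)
       + alpha * ((INR u - 1) * ln 2 + ln (ln 2))) <= weight d alpha n.
Proof.
move=> d1 a0 u1 /andP[n1 n2]; have l2 := ln2_pos.
have d1' : 1 <= INR d by apply: (le_INR 1); apply/leP.
have n1' : (2 ^ 2 ^ u.-1 <= n)%N.
  by apply: leq_trans n1; rewrite -{1}[(2 ^ 2 ^ u.-1)%N]expn1 leq_pexp2l // expn_gt0.
have n0 : 0 < INR n by apply: lt_0_INR; apply/ltP; apply: leq_trans n1'; rewrite expn_gt0.
have lnlow : exp ((INR u - 1) * ln 2) * ln 2 <= ln (INR n).
  have -> : INR u - 1 = INR u.-1 by have := S_INR u.-1; rewrite prednK //; lra.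
  rewrite exp_mul_nat exp_ln; last lra.
  rewrite -INR_pow2 -ln_INR_expn2; apply: ln_le.
    by apply: lt_0_INR; apply/ltP; rewrite expn_gt0.
  by apply: le_INR; apply/leP.
have lnup : ln (INR n) <= INR d * (INR (2 ^ u) * ln 2).
  rewrite -Rmult_assoc -mult_INR -ln_INR_expn2.
  apply: ln_le => //; apply: le_INR; apply/leP; apply: leq_trans n2 _.
  by rewrite -expnM mulnC.
have lp : 0 < ln (INR n).
  by apply: Rlt_le_trans lnlow; apply: Rmult_lt_0_compat => //; apply: exp_pos.
rewrite /weight /powR0; case: (Rlt_dec 0 (ln (INR n))) => //= lp'.
rewrite /Rpower -exp_plus; apply: exp_mono; apply: Rplus_le_compat.
  rewrite /sigma_crit.
  have : (1 / 2 - 1 / (2 * INR d)) * ln (INR n) <=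
         (1 / 2 - 1 / (2 * INR d)) * (INR d * (INR (2 ^ u) * ln 2)).
    apply: Rmult_le_compat_l lnup.
    have : / INR d <= 1 by rewrite -Rinv_1; apply: Rinv_le_contravar; lra.
    rewrite (_ : 1 / (2 * INR d) = / INR d / 2); last by field; lra.
    by lra.
  rewrite (_ : (1 / 2 - 1 / (2 * INR d)) * (INR d * (INR (2 ^ u) * ln 2)) =
     (INR d - 1) / 2 * (INR (2 ^ u) * ln 2)); last by field; lra.
  by lra.
apply: Rmult_le_compat_l; first lra.
have e0 := exp_pos ((INR u - 1) * ln 2).
rewrite -[X in X + _ <= _]ln_exp -ln_mult //.
by apply: ln_le => //; apply: Rmult_lt_0_compat.
Qed.

Lemma exists_nat_ge (x : R) : exists n : nat, x <= INR n.
Proof.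
have [n hn] := INR_unbounded x; exists n; lra.
Qed.

(** With N = 2^m there are N^d coefficients of modulus eps N^(-(d+1)/2), so the weighted sum is at
    least eps N^((d-1)/2) times the minimal weight. *)
Lemma block_exists d alpha L eps : (1 <= d)%N -> 0 < alpha ->
  (INR d - 1) / 2 < alpha -> 0 < eps <= 1 ->
  exists U b P D, is_block d alpha L eps U b P D.
Proof.
move=> d1 a0 ha [e0 e1]; have l2 := ln2_pos.
have [e he] := many_primes d.
have d1' : 1 <= INR d by apply: (le_INR 1); apply/leP.
pose g := alpha - (INR d - 1) / 2.
have g0 : 0 < g by rewrite /g; lra.
(* The weighted sum will be at least exp(u g ln 2 - K). *)
pose K := (INR d - 1) / 2 * (INR e * ln 2) + alpha * ln 2 - alpha * ln (ln 2) - ln eps.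
have [u0 hu0] := exists_nat_ge (K / (g * ln 2)).
(* The summands serve [K], [many_primes], and L < Y through L <= u-1 < 2^(u-1) < Y. *)
pose u := (u0 + (e + 4) + L.+1)%N.
have hu : K <= INR u * (g * ln 2).
  have gl : 0 < g * ln 2 by apply: Rmult_lt_0_compat.
  apply/(Rle_div_l _ _ _ gl); apply: Rle_trans hu0 _.
  by apply: le_INR; apply/leP; rewrite /u -addnA leq_addr.
have ue : (e + 4 <= u)%N by rewrite /u; lia.
have [ps [ups sps hps]] := he u ue.
set m := (2 ^ u - u - e)%N in sps.
(* The primes are cut into d rows of length 2^m; the default value 1 keeps [q] positive
   everywhere. *)
pose q j i := nth 1%N ps (j * 2 ^ m + i).
set Y := (2 ^ 2 ^ u.-1)%N in hps; set X := (2 ^ 2 ^ u)%N in hps.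
have idx j i : (j < d)%N -> (i < 2 ^ m)%N -> (j * 2 ^ m + i < size ps)%N.
  by move=> hj hi; rewrite sps; nia.
have hq j i : (j < d)%N -> (i < 2 ^ m)%N -> [/\ prime (q j i), Y < q j i & q j i <= X]%N.
  by move=> hj hi; apply: hps; apply: mem_nth; apply: idx.
have hinj j i j' i' : (j < d)%N -> (i < 2 ^ m)%N -> (j' < d)%N -> (i' < 2 ^ m)%N ->
     q j i = q j' i' -> j = j' /\ i = i'.
  move=> hj hi hj' hi' /eqP; rewrite nth_uniq ?idx // => /eqP E.
  have ej : j = j' by nia.
  by subst j'; split=> //; apply/eqP; rewrite -(eqn_add2l (j * 2 ^ m)) E.
have q0 j i : (0 < q j i)%N.
  rewrite /q; case: (ltnP (j * 2 ^ m + i) (size ps)) => h.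
    by have [/prime_gt0] := hps _ (mem_nth 1%N h).
  by rewrite nth_default.
pose w := words q m d 0.
have uw : uniq [seq x.1 | x <- w] by apply: words_uniq hq hinj _ _ _.
have spec x : x \in w -> [/\ (0 < x.1)%N, (Y ^ d <= x.1 <= X ^ d)%N & (Omega x.1 <= d)%N].
  by move=> hx; have [h1 h2 h3 _] := words_spec _ _ _ _ _ hq _ _ _ (leqnn d) hx.
have LY : (L < Y ^ d)%N.
  apply: (@leq_trans Y); last first.
    by rewrite -{1}[Y]expn1 leq_pexp2l // /Y expn_gt0.
  have h1 : (L <= u.-1)%N by rewrite /u; lia.
  exact: leq_ltn_trans h1 (ltn_trans (ltn_expl _ (ltnSn 1)) (ltn_expl _ (ltnSn 1))).
pose lN := INR m * ln 2.
have lN0 : 0 <= lN by apply: Rmult_le_pos; [exact: pos_INR|lra].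
have EN : exp lN = 2 ^ m by rewrite /lN exp_mul_nat exp_ln; lra.
(* This is eps N^(-(d+1)/2), which normalizes the squared norm N^(d+1) to eps^2. *)
pose c := eps * exp (- ((INR d + 1) / 2 * lN)).
have c0 : 0 < c by apply: Rmult_lt_0_compat => //; apply: exp_pos.
have ce : c <= eps.
  rewrite -[X in _ <= X]Rmult_1_r; apply: Rmult_le_compat_l; first lra.
  rewrite -[X in _ <= X]exp_0; apply: exp_mono.
  have : 0 <= (INR d + 1) / 2 * lN by apply: Rmult_le_pos; lra.
  lra.
have cN : c ^ 2 * (2 ^ m) ^ d.+1 = eps ^ 2.
  rewrite -EN -exp_mul_nat S_INR /c Rpow_mult_distr -exp_mul_nat Rmult_assoc -exp_plus.
  rewrite (_ : _ + _ = 0) ?exp_0 ?Rmult_1_r //= ; by field.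
pose b n := Cmult (RtoC c) (coef w n).
pose P s := Cmult (RtoC c) (poly_val q m d s 0).
pose D s := Cmult (RtoC c) (poly_der q m d s 0).
have cc : csq (RtoC c) = c ^ 2 by rewrite /csq /=; ring.
have Cc : Cmod (RtoC c) = c by rewrite Cmod_R Rabs_right //; lra.
have bn n : b n <> RtoC 0 -> n \in [seq x.1 | x <- w].
  move=> h; apply/negPn/negP => hn; apply: h.
  by rewrite /b coef_notin //; ring.
have csqP f k : 0 <= k -> csq (f 0%N) <= k * (2 ^ m) ^ d.+1 ->
    csq (Cmult (RtoC c) (f 0%N)) <= eps ^ 2 * k.
  move=> k0 h; rewrite csqM cc -cN.
  have := Rmult_le_compat_l (c ^ 2) _ _ (pow2_ge_0 c) h; lra.
exists (X ^ d)%N, b, P, D; split.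
- apply: leq_trans LY _; rewrite leq_exp2r // leq_exp2l // leq_exp2l //; lia.
- move=> n /bn /mapP[x hx ->]; have [h1 /andP[h2 h3] h4] := spec x hx.
  by split=> //; apply: leq_trans h2.
- split=> [n|s s0].
    rewrite Cmod_mult Cc; have := Cmod_coef_le1 w n uw; have := Cmod_ge_0 (coef w n); nra.
  apply: Cmod_le_csq; first lra.
  rewrite -[eps ^ 2]Rmult_1_r; apply: csqP; first lra.
  rewrite Rmult_1_l; apply: Rle_trans (sqn_poly_val q m d s (Rlt_le _ _ s0)).
  exact: csq0_le_sqn.
- move=> M s hM; rewrite /P poly_val_words //.
  rewrite -(@csum_coef w (index_iota 1 M.+1) (fun n => npowC n s)) ?iota_uniq //; last first.
    move=> n /mapP[x hx ->]; rewrite mem_index_iota ltnS; have [-> /andP[_ h] _] := spec x hx.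
    exact: leq_trans h hM.
  by rewrite big_distrr /=; apply: eq_bigr => n _; rewrite /b; ring.
split.
  move=> delta s hd ds; have k0 := poly_const_ge0 delta d hd.
  have kk : poly_const delta d <= block_const d delta ^ 2 by rewrite /block_const; nra.
  have e2 : 0 <= eps ^ 2 by apply: pow2_ge_0.
  have bc : 0 <= block_const d delta by rewrite /block_const; lra.
  split=> [|h hh]; apply: Cmod_le_csq.
  - by apply: Rmult_le_pos; lra.
  - apply: (Rle_trans _ (eps ^ 2 * poly_const delta d)).
      apply: csqP => //; apply: Rle_trans (sqn_poly_der delta q m d s hd ds).
      exact: csq0_le_sqn.
    by rewrite Rpow_mult_distr; apply: Rmult_le_compat_l.
  - by apply: Rmult_le_pos; [apply: Rmult_le_pos; lra|apply: pow2_ge_0].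
  have t4 : 0 <= Cmod h ^ 4 by apply: pow_le; apply: Cmod_ge_0.
  apply: (Rle_trans _ (eps ^ 2 * (poly_const delta d * Cmod h ^ 4))).
    rewrite (_ : taylor_rem P D s h = Cmult (RtoC c)
      (taylor_rem (fun s => poly_val q m d s 0) (fun s => poly_der q m d s 0) s h)); last first.
      by rewrite /taylor_rem /P /D; ring.
    pose f r := taylor_rem (fun s => poly_val q m d s r) (fun s => poly_der q m d s r) s h.
    apply: (csqP f); first exact: Rmult_le_pos.
    apply: Rle_trans (csq0_le_sqn m f) _.
    apply: Rle_trans (sqn_poly_rem delta q m d s h hd ds hh) _; right; ring.
  rewrite (_ : (eps * _ * _) ^ 2 = eps ^ 2 * (block_const d delta ^ 2 * Cmod h ^ 4)); last ring.
  apply: Rmult_le_compat_l => //.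
  by apply: Rmult_le_compat_r.
rewrite (eq_bigr (fun n => Cmod (coef w n) * (c * weight d alpha n))); last first.
  by move=> n _; rewrite /b Cmod_mult Cc; ring.
rewrite (@rsum_coef w (index_iota L.+1 (X ^ d).+1) (fun n => c * weight d alpha n)) ?iota_uniq //;
  last first.
  move=> n /mapP[x hx ->]; rewrite mem_index_iota ltnS; have [_ /andP[h1 h] _] := spec x hx.
  by rewrite h andbT; apply: leq_trans h1.
pose W := exp (- ((INR d - 1) / 2) * (INR (2 ^ u) * ln 2)
       + alpha * ((INR u - 1) * ln 2 + ln (ln 2))).
apply: (Rle_trans _ (\big[Rplus/0]_(x <- w) (c * W))); last first.
  apply: rsum_le => x hx; apply: Rmult_le_compat_l; first lra.
  have [_ h _] := spec x hx; apply: weight_ge => //; lia.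
rewrite rsum_const size_words INR_expn INR_pow2 -EN -exp_mul_nat /c /W.
rewrite -{1}(exp_ln eps) // -!exp_plus -[X in X <= _]exp_0; apply: exp_mono.
(* The subtractions in [m] are not truncated, as u + e <= 2^u. *)
have ml : lN = INR (2 ^ u) * ln 2 - INR u * ln 2 - INR e * ln 2.
  have u4 : (4 <= u)%N by apply: leq_trans ue; rewrite leq_addl.
  have eu : (e <= u)%N by apply: leq_trans ue; rewrite leq_addr.
  have E2 : (2 ^ u = 2 * 2 ^ u.-1)%N by rewrite -expnS prednK // (leq_trans _ u4).
  have ue2 : (u + e <= 2 ^ u)%N.
    by rewrite E2; have := ltn_add2_exp u u4; clearbody u; lia.
  by rewrite /lN /m !minus_INR; first ring; apply/leP; lia.
rewrite ml; rewrite /K /g in hu; lra.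
Qed.

(** * Gliding hump *)

Lemma sum_n_m_big (G : AbelianMonoid) (op : Monoid.law (zero : G)) (u : nat -> G) n m :
  (forall x y, op x y = plus x y) ->
  sum_n_m u n m = \big[op/zero]_(n <= i < m.+1) u i.
Proof.
move=> hop; elim: m => [|m IH].
  case: n => [|n]; first by rewrite sum_n_n big_nat1.
  by rewrite big_geq // sum_n_m_zero //; apply/ltP.
case: (leqP n m.+1) => h; last by rewrite big_geq // sum_n_m_zero //; apply/ltP.
have h' : (n <= m.+1)%coq_nat by apply/leP.
by rewrite (sum_n_Sm _ _ _ h') [RHS]big_nat_recr // IH -hop.
Qed.

Lemma sum_n_m_R (u : nat -> R) n m :
  sum_n_m u n m = \big[Rplus/0]_(n <= i < m.+1) u i.
Proof. exact: (@sum_n_m_big R_AbelianMonoid Rplus). Qed.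

Lemma sum_n_C (u : nat -> C) m :
  sum_n (G := C_AbelianMonoid) u m = \big[Cplus/RtoC 0]_(0 <= i < m.+1) u i.
Proof. exact: (@sum_n_m_big C_AbelianMonoid Cplus). Qed.

Lemma geom_half_sum n : \big[Rplus/0]_(0 <= k < n) (1 / 2) ^ k <= 2.
Proof.
suff -> : \big[Rplus/0]_(0 <= k < n) (1 / 2) ^ k = 2 * (1 - (1 / 2) ^ n).
  have : 0 < (1 / 2) ^ n by apply: pow_lt; lra.
  lra.
elim: n => [|n IH]; first by rewrite big_geq //=; lra.
by rewrite big_nat_recr //= IH; lra.
Qed.

Notation is_cseries := (@is_series C_AbsRing C_NormedModule).
Notation ex_cseries := (@ex_series C_AbsRing C_NormedModule).

Lemma ex_series_half A : ex_series (fun k => (1 / 2) ^ k * A).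
Proof.
apply: (ex_series_ext (fun k => scal A ((1 / 2) ^ k))).
  by move=> k; rewrite /scal /= /mult /=; ring.
by apply: ex_series_scal; apply: ex_series_geom; rewrite Rabs_right; lra.
Qed.

Lemma ex_cseries_half (u : nat -> C) A :
  (forall k, Cmod (u k) <= (1 / 2) ^ k * A) -> ex_cseries u.
Proof.
move=> h; apply: (@ex_series_le C_AbsRing C_CompleteNormedModule _ (fun k => (1 / 2) ^ k * A)).
  exact: h.
exact: ex_series_half.
Qed.

Lemma Cmod_series_le (u : nat -> C) l A :
  (forall k, Cmod (u k) <= (1 / 2) ^ k * A) -> is_cseries u l -> Cmod l <= 2 * A.
Proof.
move=> h hl.
have A0 : 0 <= A by have := h 0%N; have := Cmod_ge_0 (u 0%N); rewrite /=; lra.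
apply: (is_lim_seq_le (fun n => Cmod (sum_n (G := C_AbelianMonoid) u n)) (fun _ => 2 * A)
  (Cmod l) (2 * A)).
- move=> n; rewrite sum_n_C; apply: Rle_trans (Cmod_csum _ _ _ _) _.
  apply: (Rle_trans _ (\big[Rplus/0]_(0 <= k < n.+1) ((1 / 2) ^ k * A))).
    by apply: rsum_le => k _; apply: h.
  rewrite -big_distrl /=; apply: Rmult_le_compat_r => //; exact: geom_half_sum.
- exact: (filterlim_comp _ _ _ _ _ _ _ _ hl (@filterlim_norm C_AbsRing C_NormedModule l)).
- exact: is_lim_seq_const.
Qed.

(** Comparison with a telescoping series: 1/n^2 <= 2 (1/n - 1/(n+1)). *)
Lemma ex_series_inv_succ_sq : ex_series (fun k : nat => / (INR k.+1) ^ 2).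
Proof.
apply: (@ex_series_le R_AbsRing R_CompleteNormedModule _
  (fun k : nat => scal 2 (/ INR k.+1 - / INR k.+2))).
  move=> k; rewrite /norm /= /abs /= /scal /= /mult /=.
  rewrite -[match k with 0%N => 1 | _.+1 => INR k + 1 end]/(INR k.+1).
  rewrite -[INR k.+1 + 1]/(INR k.+2).
  have k0 := pos_INR k; rewrite !S_INR.
  have p : 0 < / ((INR k + 1) * ((INR k + 1) * 1)) by apply: Rinv_0_lt_compat; nra.
  rewrite Rabs_right; last lra.
  rewrite (_ : / (INR k + 1) - / (INR k + 1 + 1) = / ((INR k + 1) * (INR k + 2))); last by field; lra.
  rewrite (_ : 2 * / ((INR k + 1) * (INR k + 2)) = / ((INR k + 1) * ((INR k + 2) / 2))); last by field; lra.
  by apply: Rinv_le_contravar; nra.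
apply: ex_series_scal; exists 1.
change (is_lim_seq (sum_n (fun k => / INR k.+1 - / INR k.+2)) 1).
apply: (is_lim_seq_ext (fun n => 1 - / INR n.+2)).
  move=> n; elim: n => [|n IH].
    by rewrite sum_O /=; field.
  rewrite sum_Sn -IH /plus /=; ring.
rewrite -{2}(Rminus_0_r 1).
apply: is_lim_seq_minus'; first exact: is_lim_seq_const.
apply: (is_lim_seq_inv (fun n => INR n.+2) p_infty) => //.
apply: (proj1 (is_lim_seq_incr_1 (fun n => INR n.+1) _)).
exact: (proj1 (is_lim_seq_incr_1 INR _) is_lim_seq_INR).
Qed.

Lemma ex_derive_of_taylor_rem (F : C -> C) (s l : C) (r K : R) : 0 < r -> 0 <= K ->
  (forall h, Cmod h <= r -> Cmod (taylor_rem F (fun _ => l) s h) <= K * Cmod h ^ 2) ->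
  @ex_derive C_AbsRing C_NormedModule F s.
Proof.
move=> r0 K0 hF; exists l; split; first exact: is_linear_scal_l.
move=> x hx; have {x hx} <- := @is_filter_lim_locally_unique _ (AbsRing_NormedModule C_AbsRing) _ _ hx.
move=> eps; have e0 := cond_pos eps.
(* The denominator K + 1 avoids division by zero when K = 0. *)
have rho0 : 0 < Rmin r (eps / (K + 1)) by apply: Rmin_pos => //; apply: Rdiv_lt_0_compat; lra.
exists (mkposreal _ rho0) => y /= hy.
have {}hy : Cmod (Cminus y s) < Rmin r (eps / (K + 1)) by exact: hy.
have hr := Rlt_le_trans _ _ _ hy (Rmin_l _ _).
have he := Rlt_le_trans _ _ _ hy (Rmin_r _ _).
have := hF (Cminus y s) (Rlt_le _ _ hr).
rewrite /taylor_rem (_ : Cplus s (Cminus y s) = y); last by ring.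
move=> h; apply: (Rle_trans _ (K * Cmod (Cminus y s) ^ 2)); first exact: h.
have t0 := Cmod_ge_0 (Cminus y s); set t := Cmod _ in he t0 *.
change (K * t ^ 2 <= eps * t).
have : t * (K + 1) < eps by apply/Rlt_div_r => //; lra.
nra.
Qed.

(** The supports fill consecutive intervals, so each coefficient comes from one block and each block
    adds at least 1 to the weighted sum, while the norms 2^-k make the sum of the [P k] bounded and
    holomorphic. *)
Lemma gliding_hump (d : nat) (alpha : R) (Ls : nat -> nat) (b : nat -> nat -> C)
    (P D : nat -> C -> C) :
  (forall k, is_block d alpha (Ls k) ((1 / 2) ^ k) (Ls k.+1) (b k) (P k) (D k)) ->
  Ls 0%N = 0%N ->
  exists a, Hinf_deg d a /\
    ~ ex_series (fun k : nat => Cmod (a k.+1) * weight d alpha k.+1).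
Proof.
move=> hb L0.
have Llt k : (Ls k < Ls k.+1)%N by case: (hb k).
have Lmono : {homo Ls : i j / (i <= j)%N}.
  by apply: homo_leq => // [k|k]; [exact: leq_trans|exact: ltnW].
have Lk k : (k <= Ls k)%N.
  by elim: k => // k IH; apply: leq_ltn_trans IH (Llt k).
have bsupp k n : b k n <> RtoC 0 -> [/\ (Ls k < n)%N, (n <= Ls k.+1)%N & (Omega n <= d)%N].
  by case: (hb k) => _ h _ _ _; apply: h.
have bz k n : ~~ ((Ls k < n) && (n <= Ls k.+1))%N -> b k n = RtoC 0.
  move=> h; case: (excluded_middle_informative (b k n = RtoC 0)) => // /bsupp[h1 h2 _].
  by rewrite h1 h2 in h.
(* As [k <= Ls k], only the blocks [k < n] can reach [n]. *)
pose a n := \big[Cplus/RtoC 0]_(0 <= k < n) b k n.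
have a_trunc n K : (n <= Ls K)%N -> a n = \big[Cplus/RtoC 0]_(0 <= k < K) b k n.
  have aux i j : (i <= j)%N -> (n <= Ls i)%N ->
      \big[Cplus/RtoC 0]_(0 <= k < j) b k n = \big[Cplus/RtoC 0]_(0 <= k < i) b k n.
    move=> ij ni; rewrite (@big_cat_nat _ _ _ i) //= [X in Cplus _ X]big1_seq ?Cplus_0_r //.
    move=> k /andP[_]; rewrite mem_index_iota => /andP[ik _]; apply: bz.
    by rewrite negb_and -leqNgt (leq_trans ni (Lmono _ _ ik)).
  move=> nK; case: (leqP n K) => h; first by rewrite (aux n K) //.
  by rewrite /a (aux K n) // ltnW.
have a_block k n : (Ls k < n <= Ls k.+1)%N -> a n = b k n.
  case/andP => h1 h2; rewrite (a_trunc n k.+1 h2) big_nat_recr //= big1_seq ?Cplus_0_l //.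
  move=> j /andP[_]; rewrite mem_index_iota => /andP[_ jk]; apply: bz.
  by rewrite negb_and orbC -ltnNge (leq_ltn_trans (Lmono _ _ jk) h1).
have cover n : (0 < n)%N -> exists k, (Ls k < n <= Ls k.+1)%N.
  move=> n0; suff H K : (n <= Ls K)%N -> exists k, (Ls k < n <= Ls k.+1)%N by exact: H (Lk n).
  elim: K => [|K IH]; first by rewrite L0 leqNgt n0.
  case: (leqP n (Ls K)) => h; first by move=> _; apply: IH.
  by move=> h'; exists K; rewrite h h'.
have half1 k : (1 / 2) ^ k <= 1.
  by rewrite -[X in _ <= X](pow1 k); apply: pow_incr; lra.
have a_le1 n : (0 < n)%N -> Cmod (a n) <= 1.
  case/cover => k /a_block ->; case: (hb k) => _ _ [h _] _ _.
  exact: Rle_trans (h n) (half1 k).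
have Ple k s : 0 < Re s -> Cmod (P k s) <= (1 / 2) ^ k * 1.
  by move=> s0; rewrite Rmult_1_r; case: (hb k) => _ _ [_ h] _ _; apply: h.
(* The sum of the [P k], meaningful where the series converges, in particular for Re s > 0. *)
pose F s := epsilon (inhabits (RtoC 0)) (fun l => is_cseries (fun k => P k s) l).
have hF s : 0 < Re s -> is_cseries (fun k => P k s) (F s).
  by move=> s0; apply: epsilon_spec; apply: ex_cseries_half (fun k => Ple k s s0).
exists a; split; last first.
  move=> /Cauchy_ex_series => hC.
  have h1 : 0 < 1 by lra.
  (* Block [K] violates the Cauchy criterion with bound 1. The k-th term belongs to n = k + 1, so
     the block occupies the indices from [Ls K] to [Ls K.+1 - 1]. *)
  have [K hK] := hC (mkposreal 1 h1).
  have Lp : (Ls K.+1 = (Ls K.+1).-1.+1)%N by rewrite prednK // (leq_ltn_trans _ (Llt K)).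
  have K1 : (K <= Ls K)%coq_nat by apply/leP.
  have K2 : (K <= (Ls K.+1).-1)%coq_nat by apply/leP; rewrite -ltnS -Lp; apply: leq_ltn_trans (Llt K).
  have := hK (Ls K) (Ls K.+1).-1 K1 K2.
  rewrite sum_n_m_R -Lp; apply: Rle_not_lt.
  have [_ _ _ _ [_ hw]] := hb K.
  apply: Rle_trans hw _; apply: Rle_trans (Rle_abs _) ; right.
  rewrite big_add1 /=; apply: eq_big_nat => i hi.
  by rewrite (a_block K).
split; last first.
  move=> n n0 an; have [k hk] := cover n n0.
  by rewrite (a_block _ _ hk) in an; case: (bsupp _ _ an).
(* For Re s > 2 the bound |a_n| <= 1 gives absolute convergence by comparison with 1/n^2. *)
exists 2, F; split; first lra.
split; last split; last first.
- exists 2 => s s0; rewrite -[X in _ <= X]Rmult_1_r.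
  exact: Cmod_series_le (fun k => Ple k s s0) (hF s s0).
- move=> s s0.
  pose delta := Rmin 1 (Re s).
  have hd : 0 < delta <= 1.
    by split; [apply: Rmin_pos => //; lra|apply: Rmin_l].
  have ds : delta <= Re s by apply: Rmin_r.
  pose K := block_const d delta.
  have K0 : 0 <= K by have := poly_const_ge0 delta d hd; rewrite /K /block_const; lra.
  have hk k := let: And5 _ _ _ _ h := hb k in proj1 h delta s hd ds.
  (* The derivative of [F] is the sum of the [D k]; its remainder is the sum of the remainders of
     the blocks. *)
  have [l hl] := ex_cseries_half _ K (fun k => proj1 (hk k)).
  apply: (@ex_derive_of_taylor_rem F s l (delta / 2) (2 * K)); try lra.
  move=> h hh; rewrite Rmult_assoc.
  apply: (@Cmod_series_le (fun k => taylor_rem (P k) (D k) s h)).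
    by move=> k; rewrite -Rmult_assoc; apply: (proj2 (hk k)).
  have sh0 : 0 < Re (Cplus s h).
    have := re_le_Cmod h; have := Rabs_maj2 (Re h).
    by rewrite (_ : Re (Cplus s h) = Re s + Re h) //; lra.
  have i1 := is_series_minus _ _ _ _ (hF _ sh0) (hF _ s0).
  exact: is_series_minus _ _ _ _ i1 (is_series_scal h _ _ hl).
move=> s s2.
have s0 : 0 < Re s by lra.
have term_le k : Cmod (dirichlet_term a s k) <= / (INR k.+1) ^ 2.
  rewrite /dirichlet_term Cmod_mult Cmod_npowC.
  have p : 0 < INR k.+1 by apply: lt_0_INR; apply/ltP.
  have E : exp (- (Re s * ln (INR k.+1))) <= / (INR k.+1) ^ 2.
    rewrite -{2}(exp_ln _ p) -exp_mul_nat -exp_Ropp; apply: exp_mono.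
    have := ln_INR_ge0 k.+1; rewrite (_ : INR 2 = 2) // ; nra.
  have := exp_pos (- (Re s * ln (INR k.+1))); have := a_le1 k.+1 isT.
  have := Cmod_ge_0 (a k.+1); nra.
have [S hS] : ex_cseries (dirichlet_term a s).
  by apply: (@ex_series_le C_AbsRing C_CompleteNormedModule _ _ term_le ex_series_inv_succ_sq).
suff -> : F s = S by [].
(* Cut at the ends of the blocks, the partial sums of the Dirichlet series are those of the series
   of the [P k], so both limits agree. *)
have sub : filterlim (fun K => (Ls K.+1).-1) eventually eventually.
  apply: eventually_subseq_loc; exists 0%N => n _; apply/ltP.
  have h := Llt n.+1; have h' := Llt n; lia.
have hS' := filterlim_comp _ _ _ _ _ _ _ _ sub hS.
apply: (filterlim_locally_unique (K := C_AbsRing) (V := C_NormedModule) _ _ _ (hF s s0)).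
apply: filterlim_ext hS' => K /=.
rewrite !sum_n_C prednK; last by apply: leq_ltn_trans (Llt K).
rewrite (eq_big_nat _ _ (F2 := fun i => \big[Cplus/RtoC 0]_(0 <= k < K.+1)
    Cmult (b k i.+1) (npowC i.+1 s))); last first.
  move=> i /andP[_ hi]; rewrite /dirichlet_term (a_trunc _ K.+1) //.
  by rewrite big_distrl.
rewrite exchange_big_nat /=; apply: eq_big_nat => k /andP[_ hk].
have [_ _ _ h _] := hb k.
rewrite -(h (Ls K.+1) s); last exact: Lmono.
by rewrite [RHS]big_add1.
Qed.

Theorem theorem3p1 (d : nat) (hd : (1 <= d)%N) (alpha : R) (halpha : 0 < alpha)
  (hsum : forall a : nat -> C, Hinf_deg d a ->
     ex_series (fun k : nat =>
       Cmod (a k.+1) * Rpower (INR k.+1) (- sigma_crit d)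
         * powR0 (ln (INR k.+1)) alpha)) :
  alpha <= (INR d - 1) / 2.
Proof.
apply: Rnot_lt_le => ha.
have half k : 0 < (1 / 2) ^ k <= 1.
  by split; [apply: pow_lt; lra|rewrite -[X in _ <= X](pow1 k); apply: pow_incr; lra].
have ex L k : exists x : nat * (nat -> C) * (C -> C) * (C -> C),
    is_block d alpha L ((1 / 2) ^ k) x.1.1.1 x.1.1.2 x.1.2 x.2.
  have [U [b [P [D h]]]] := block_exists d alpha L _ hd halpha ha (half k).
  by exists (U, b, P, D).
(* The blocks are chosen one after another, each starting where the previous one ends. *)
pose next L k := proj1_sig (constructive_indefinite_description _ (ex L k)).
pose Ls := fix Ls k := if k is k'.+1 then (next (Ls k') k').1.1.1 else 0%N.
have [|//|a [hH hdiv]] := @gliding_hump d alpha Ls (fun k => (next (Ls k) k).1.1.2)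
    (fun k => (next (Ls k) k).1.2) (fun k => (next (Ls k) k).2).
  by move=> k; apply: (proj2_sig (constructive_indefinite_description _ (ex (Ls k) k))).
apply: hdiv; apply: ex_series_ext (hsum a hH) => k.
by rewrite /weight Rmult_assoc.
Qed.
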